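(* Assume that a rank-$R$ tensor $\mathcal{Y}$ of order $N$ and size $I_1\times\cdots\times I_N$ has a unique CPD given by $[\![\mathbf{A}^{(1)},\mathbf{A}^{(2)},\ldots,\mathbf{A}^{(N)}]\!]$, with $\mathbf{A}^{(n)}$ of size $I_n\times R$, and a TT representation of rank-$(R,\ldots,R)$, that is $$\mathcal{Y} = [\![\mathbf{A}^{(1)},\mathbf{A}^{(2)},\ldots,\mathbf{A}^{(N)}]\!] = \mathbf{G}_1\bullet\mathcal{G}_2\bullet\cdots\bullet\mathcal{G}_{N-1}\bullet\mathbf{G}_N .$$ Then, for $n=2,\ldots,N-1$, the core tensor $\mathcal{G}_n$ can be equivalently expressed by a K-tensor of $R$ components, the second factor matrix of which is $\mathbf{A}^{(n)}$ up to scaling and column permutation. Namely, there are matrices $\mathbf{Q}_n,\mathbf{S}_n$ of size $R\times R$ ($n=2,\ldots,N-1$) and vectors $\boldsymbol{\gamma}_1,\boldsymbol{\gamma}_2,\ldots,\boldsymbol{\gamma}_{N-2},\boldsymbol{\gamma}_N$ of length $R$ such that $$\mathcal{G}_n = [\![\mathbf{Q}_n,\mathbf{A}^{(n)},\mathbf{S}_n]\!],\qquad n=2,\ldots,N-1,$$ $$\mathbf{A}^{(1)} = \mathbf{G}_1\,\mathbf{Q}_2\,\mathrm{diag}(\boldsymbol{\gamma}_1),\qquad \mathbf{A}^{(N)} = \mathbf{G}_N^T\,\mathbf{S}_{N-1}\,\mathrm{diag}(\boldsymbol{\gamma}_N),$$ $$\mathbf{S}_n^T\,\mathbf{Q}_{n+1}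 = \mathrm{diag}(\boldsymbol{\gamma}_n),\qquad n=2,\ldots,N-2,$$ and $\boldsymbol{\gamma}_1\circledast\boldsymbol{\gamma}_2\circledast\cdots\circledast\boldsymbol{\gamma}_{N-2}\circledast\boldsymbol{\gamma}_N=\mathbf{1}_R$.
   Context: Tensor train contraction: for a tensor $\mathcal{A}$ of size $I_1\times\cdots\times I_N$ and a tensor $\mathcal{B}$ of size $J_1\times\cdots\times J_K$ with $I_N=J_1$, $\mathcal{A}\bullet\mathcal{B}$ is the tensor of size $I_1\times\cdots\times I_{N-1}\times J_2\times\cdots\times J_K$ with entries $\sum_{i_N=1}^{I_N} a_{i_1,\ldots,i_{N-1},i_N}\,b_{i_N,j_2,\ldots,j_K}$. TT representation: $\mathcal{Y}=\mathcal{G}_1\bullet\cdots\bullet\mathcal{G}_N$ with core tensors $\mathcal{G}_n$ of size $R_{n-1}\times I_n\times R_n$, $R_0=R_N=1$; the first and last cores are matrices, written $\mathbf{G}_1$ (size $I_1\times R_1$) and $\mathbf{G}_N$ (size $R_{N-1}\times I_N$). The tuple $(R_1,\ldots,R_{N-1})$ represents the TT-rank. Rank-$(R,\ldots,R)$ means $R_1=\cdots=R_{N-1}=R$. K-tensor (Kruskal tensor): for matrices $\mathbf{A}^{(n)}=[\mathbf{a}^{(n)}_1,\ldots,\mathbf{a}^{(n)}_R]\in\mathbb{R}^{I_n\times R}$, $[\![\mathbf{A}^{(1)},\ldots,\mathbf{A}^{(N)}]\!]=\sum_{r=1}^R\mathbf{a}^{(1)}_r\circ\cdots\circ\mathbf{a}^{(N)}_r$,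 where $\circ$ is the outer product; $R$ is its number of components. A CPD of rank $R$ of $\mathcal{Y}$ is an expression of $\mathcal{Y}$ as such a K-tensor with $R$ components, where $R$ is the tensor rank. Uniqueness of the CPD is understood up to a common permutation of the columns of the factor matrices and scaling of the columns (with the scalings of each rank-one term multiplying to one). $\circledast$ is the Hadamard (entrywise) product, $\mathbf{1}_R$ the vector of ones of length $R$, and $\mathrm{diag}(\boldsymbol{\gamma})$ the diagonal matrix with diagonal $\boldsymbol{\gamma}$. Here $N\ge 3$.
   Formalization: ''TT representation of rank-(R,…,R)'' is taken to mean that (R,…,R) is the TT-rank of Y, i.e. the bond dimensions are the least possible; with only the core sizes fixed the claim fails (e.g. size 2×3×3, R = 3). *)

(* Defs.v *)
From HB Require Import structures.
From mathcomp Require Import all_boot all_order all_fingroup all_algebra.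

Set Implicit Arguments.
Unset Strict Implicit.
Unset Printing Implicit Defensive.

Import GRing.Theory.
Local Open Scope ring_scope.

(* A tensor of size [:: n_1; ...; n_N] is a nested finite function with entries
   T i_1 ... i_N.  In sizes, tt_tail and factors_of, which are recursive, families
   indexed by nat start at 0; everywhere else they start at 1, members outside
   the range of mode numbers being ignored.  Shifting the family at each
   recursive call makes all the size constraints hold by conversion. *)
Fixpoint tensor (K : fieldType) (s : seq nat) : lmodType K :=
  if s is n :: s' then {ffun 'I_n -> tensor K s'} : lmodType K else K^o.

Definition mxtensor (K : fieldType) (m n : nat) (A : 'M[K]_(m, n)) :
    tensor K [:: m; n] :=
  [ffun i : 'I_m => [ffun j : 'I_n => (A i j : K^o)] : tensor K [:: n]].

(* The sizes [:: I 0; ...; I N.-1]; equal, but not convertible under the shift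
   of I, to mkseq I N. *)
Fixpoint sizes (N : nat) (I : nat -> nat) : seq nat :=
  if N is N'.+1 then I 0%N :: sizes N' (fun n => I n.+1) else [::].

(* The product A \bullet B: the last mode of A, of dimension k, is summed
   against the first mode of B. *)
Fixpoint contract (K : fieldType) (s : seq nat) (k : nat) (t : seq nat) :
    tensor K (rcons s k) -> tensor K (k :: t) -> tensor K (s ++ t) :=
  match s return tensor K (rcons s k) -> tensor K (k :: t) -> tensor K (s ++ t)
  with
  | [::] => fun (A : {ffun 'I_k -> K^o}) (B : {ffun 'I_k -> tensor K t}) =>
      \sum_(l < k) (A l : K) *: B l
  | n :: s' => fun (A : {ffun 'I_n -> tensor K (rcons s' k)}) B =>
      [ffun i : 'I_n => @contract K s' k t (A i) B]
  end.

Fixpoint tt_tail (K : fieldType) (m : nat) :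
  forall (I r : nat -> nat) (G : forall n, tensor K [:: r n; I n; r n.+1])
    (L : tensor K [:: r m; I m]), tensor K (r 0%N :: sizes m.+1 I) :=
  match m return
    forall (I r : nat -> nat) (G : forall n, tensor K [:: r n; I n; r n.+1])
      (L : tensor K [:: r m; I m]), tensor K (r 0%N :: sizes m.+1 I)
  with
  | 0%N => fun I r G L => L
  | m'.+1 => fun I r G L =>
      @contract K [:: r 0%N; I 0%N] (r 1%N) (sizes m'.+1 (fun n => I n.+1))
        (G 0%N)
        (@tt_tail K m' (fun n => I n.+1) (fun n => r n.+1) (fun n => G n.+1) L)
  end.

(* The tensor train G_1 \bullet (G_2 \bullet ( ... \bullet G_N)) of order N >= 2
   and bond dimensions r 1, ..., r N.-1, the outer cores G_1 = G1 and G_N = GN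
   being matrices.  The value 0 for N < 2 is a convention. *)
Definition tensor_train (K : fieldType) (N : nat) (I r : nat -> nat)
    (G1 : 'M[K]_(I 1%N, r 1%N))
    (G : forall n, tensor K [:: r n.-1; I n; r n])
    (GN : 'M[K]_(r N.-1, I N)) : tensor K (sizes N (fun n => I n.+1)) :=
  match N return
    'M[K]_(r N.-1, I N) -> tensor K (sizes N (fun n => I n.+1))
  with
  | m.+2 => fun GN =>
      @contract K [:: I 1%N] (r 1%N) (sizes m.+1 (fun n => I n.+2))
        (mxtensor G1)
        (@tt_tail K m (fun n => I n.+2) (fun n => r n.+1) (fun n => G n.+2)
          (mxtensor GN))
  | _ => fun _ => 0
  end GN.

Definition has_tt (K : fieldType) (N : nat) (I : nat -> nat)
    (Y : tensor K (sizes N (fun n => I n.+1))) (r : nat -> nat) : Prop :=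
  exists (G1 : 'M[K]_(I 1%N, r 1%N))
    (G : forall n, tensor K [:: r n.-1; I n; r n])
    (GN : 'M[K]_(r N.-1, I N)), Y = tensor_train G1 G GN.

(* The TT-rank (r 1, ..., r N.-1) is the componentwise least tuple of bond
   dimensions among all TT representations. *)
Definition tt_rank (K : fieldType) (N : nat) (I : nat -> nat)
    (Y : tensor K (sizes N (fun n => I n.+1))) (r : nat -> nat) : Prop :=
  has_tt Y r /\
  forall r' : nat -> nat, has_tt Y r' ->
    forall n : nat, (1 <= n < N)%N -> (r n <= r' n)%N.

Fixpoint factors (K : fieldType) (R : nat) (s : seq nat) : Type :=
  if s is n :: s' then ('M[K]_(n, R) * factors K R s')%type else unit.

Definition outer (K : fieldType) (n : nat) (s : seq nat) (a : 'cV[K]_n)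
    (T : tensor K s) : tensor K (n :: s) :=
  [ffun i : 'I_n => a i 0 *: T].

Fixpoint rank1 (K : fieldType) (R : nat) (r : 'I_R) (s : seq nat) :
    factors K R s -> tensor K s :=
  match s return factors K R s -> tensor K s with
  | [::] => fun _ => (1 : K)
  | n :: s' => fun A => outer (col r A.1) (rank1 r A.2)
  end.

Definition ktensor (K : fieldType) (R : nat) (s : seq nat)
    (A : factors K R s) : tensor K s := \sum_(r < R) rank1 r A.

Definition ktensor3 (K : fieldType) (R n1 n2 n3 : nat) (A : 'M[K]_(n1, R))
    (B : 'M[K]_(n2, R)) (C : 'M[K]_(n3, R)) : tensor K [:: n1; n2; n3] :=
  @ktensor K R [:: n1; n2; n3] (A, (B, (C, tt))).

Fixpoint factors_of (K : fieldType) (R N : nat) :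
    forall I : nat -> nat,
    (forall n, 'M[K]_(I n, R)) -> factors K R (sizes N I) :=
  match N return
    forall I : nat -> nat,
    (forall n, 'M[K]_(I n, R)) -> factors K R (sizes N I)
  with
  | 0%N => fun _ _ => tt
  | N'.+1 => fun I A =>
      (A 0%N, @factors_of K R N' (fun n => I n.+1) (fun n => A n.+1))
  end.

Definition kruskal (K : fieldType) (R N : nat) (I : nat -> nat)
    (A : forall n, 'M[K]_(I n, R)) : tensor K (sizes N (fun n => I n.+1)) :=
  ktensor (@factors_of K R N (fun n => I n.+1) (fun n => A n.+1)).

Definition tensor_rank (K : fieldType) (s : seq nat) (Y : tensor K s)
    (R : nat) : Prop :=
  (exists A : factors K R s, Y = ktensor A) /\
  forall (R' : nat) (B : factors K R' s), Y = ktensor B -> (R <= R')%N.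

Definition is_cpd (K : fieldType) (R N : nat) (I : nat -> nat)
    (Y : tensor K (sizes N (fun n => I n.+1)))
    (A : forall n, 'M[K]_(I n, R)) : Prop :=
  tensor_rank Y R /\ Y = kruskal N A.

Definition unique_cpd (K : fieldType) (R N : nat) (I : nat -> nat)
    (Y : tensor K (sizes N (fun n => I n.+1)))
    (A : forall n, 'M[K]_(I n, R)) : Prop :=
  is_cpd Y A /\
  forall B : forall n, 'M[K]_(I n, R), is_cpd Y B ->
    exists (sigma : 'S_R) (d : nat -> 'rV[K]_R),
      (forall n : nat, (1 <= n <= N)%N ->
         B n = col_perm sigma (A n) *m diag_mx (d n)) /\
      (forall r : 'I_R, \prod_(1 <= n < N.+1) d n 0 r = 1).

Definition hadamard (K : fieldType) (m n : nat) (A B : 'M[K]_(m, n)) :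
  'M[K]_(m, n) := map2_mx *%R A B.

(* Main.v *)
(* Cut the train between the modes n and n+1.  A matrix inserted at this bond
   without changing the tensor must have rank R: otherwise its rank factorization
   would give a train with a smaller n-th bond, against the minimality of the
   TT-rank.  Inserting projections onto the spans of the left and of the right
   partial products of the cores shows that both span the whole R-dimensional
   space.  The CPD is itself a train with diagonal cores diag(A_n(j, :)), so the
   two trains differ at each bond by an invertible W_n.  Cancelling the left
   partial products gives G_n(:, j, :) = W_{n-1} diag(A_n(j, :)) W_n^-1, that is
   Q_n = W_{n-1}, S_n = W_n^-T and all the gamma_n are equal to 1. *)
Require Import Defs.
From HB Require Import structures.
From mathcomp Require Import all_boot all_order all_fingroup all_algebra.
From mathcomp Require Import boolp.
From mathcomp Require Import reals.

Set Implicit Arguments.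
Unset Strict Implicit.
Unset Printing Implicit Defensive.

Import GRing.Theory.
Local Open Scope ring_scope.

(* Tensors and matrices are indexed by nat with value 0 out of range, so that one
   index function nat -> nat serves for all the modes. *)
Definition ext0 (V : nmodType) (n : nat) (f : 'I_n -> V) (i : nat) : V :=
  oapp f 0 (insub i).

Lemma ext0_ord (V : nmodType) (n : nat) (f : 'I_n -> V) (i : 'I_n) :
  ext0 f i = f i.
Proof. by rewrite /ext0 valK. Qed.

Lemma ext0_comp (V W : nmodType) (n : nat) (g : V -> W) (f : 'I_n -> V)
    (i : nat) : g 0 = 0 -> ext0 (g \o f) i = g (ext0 f i).
Proof. by rewrite /ext0; case: insub. Qed.

Lemma eq_ext0 (V : nmodType) (n : nat) (f g : 'I_n -> V) (i : nat) :
  f =1 g -> ext0 f i = ext0 g i.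
Proof. by move=> eqfg; rewrite /ext0; case: insub => //= j; rewrite eqfg. Qed.

(** * Entries of tensors as functions of a multi-index *)

Section Entries.
Variable K : fieldType.

Fixpoint entry (s : seq nat) : tensor K s -> (nat -> nat) -> K :=
  match s return tensor K s -> (nat -> nat) -> K with
  | [::] => fun T _ => T
  | n :: s' => fun (T : {ffun 'I_n -> tensor K s'}) i =>
      ext0 (fun j => entry (T j) (fun n => i n.+1)) (i 0%N)
  end.

Lemma entry_inj (s : seq nat) (S T : tensor K s) :
  entry S =1 entry T -> S = T.
Proof.
elim: s S T => [|n s IHs] /= S T eqST; first exact: (eqST id).
apply/ffunP => j; apply: IHs => i.
by have:= eqST (fun k => if k is k'.+1 then i k' else j); rewrite !ext0_ord.
Qed.

Lemma entry_is_linear (s : seq nat) (i : nat -> nat) (c : K) (S T : tensor K s) :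
  entry (c *: S + T) i = c * entry S i + entry T i.
Proof.
elim: s i S T => [|n s IHs] //= i S T.
rewrite /ext0; case: insub => [j|] /=; last by rewrite mulr0 addr0.
by rewrite !ffunE IHs.
Qed.

Lemma entry0 (s : seq nat) (i : nat -> nat) : entry (0 : tensor K s) i = 0.
Proof.
have := entry_is_linear i (-1) (0 : tensor K s) 0.
by rewrite scaler0 addr0 mulN1r addNr.
Qed.

Lemma entryZ (s : seq nat) (i : nat -> nat) (c : K) (T : tensor K s) :
  entry (c *: T) i = c * entry T i.
Proof. by rewrite -[c *: T]addr0 entry_is_linear entry0 addr0. Qed.

Lemma entry_sum (s : seq nat) (i : nat -> nat) (J : finType)
    (T : J -> tensor K s) :
  entry (\sum_l T l) i = \sum_l entry (T l) i.
Proof.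
apply: (big_morph (fun T => entry T i)); last exact: entry0.
by move=> S T'; rewrite -[S]scale1r entry_is_linear mul1r scale1r.
Qed.

(** This is the matrix T(:, j, :); in terms of it, contracting cores amounts to multiplying
    matrices. *)
Definition core_slice (p n q : nat) (T : tensor K [:: p; n; q]) :
    nat -> 'M[K]_(p, q) :=
  ext0 (fun j : 'I_n => \matrix_(a, b)
    (((T : {ffun 'I_p -> tensor K [:: n; q]}) a
        : {ffun 'I_n -> tensor K [:: q]}) j : {ffun 'I_q -> K^o}) b).

Definition nat_row (m n : nat) (A : 'M[K]_(m, n)) : nat -> 'rV[K]_n :=
  ext0 (fun j => row j A).

Definition nat_col (m n : nat) (A : 'M[K]_(m, n)) : nat -> 'cV[K]_m :=
  ext0 (fun j => col j A).

Lemma nat_row_mulmx (m n p : nat) (A : 'M[K]_(m, n)) (B : 'M[K]_(n, p)) i :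
  nat_row (A *m B) i = nat_row A i *m B.
Proof.
rewrite /nat_row -(ext0_comp (g := mulmx^~ B)) ?mul0mx //.
by apply: eq_ext0 => j; rewrite /= row_mul.
Qed.

Lemma nat_col_mulmx (m n p : nat) (A : 'M[K]_(m, n)) (B : 'M[K]_(n, p)) i :
  nat_col (A *m B) i = A *m nat_col B i.
Proof.
rewrite /nat_col -(ext0_comp (g := mulmx A)) ?mulmx0 //.
by apply: eq_ext0 => j; rewrite /= !colE mulmxA.
Qed.

Lemma nat_col_tr (m n : nat) (A : 'M[K]_(m, n)) i :
  nat_col A^T i = (nat_row A i)^T.
Proof.
rewrite /nat_col -(ext0_comp (g := trmx)) ?trmx0 //.
by apply: eq_ext0 => j; rewrite /= tr_row.
Qed.

Lemma nat_row_inj (m n : nat) (A B : 'M[K]_(m, n)) :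
  nat_row A =1 nat_row B -> A = B.
Proof.
move=> eqAB; apply/row_matrixP => j.
by have := eqAB j; rewrite /nat_row !ext0_ord.
Qed.

(** * Entries of tensor trains as matrix products *)

Lemma entry_contract (n k : nat) (t : seq nat) (T : tensor K [:: n; k])
    (U : tensor K (k :: t)) (i : nat -> nat) :
  entry (@contract K [:: n] k t T U) i =
  ext0 (fun j : 'I_n => \sum_(l < k)
    ((T : {ffun 'I_n -> tensor K [:: k]}) j : {ffun 'I_k -> K^o}) l *
    entry ((U : {ffun 'I_k -> tensor K t}) l) (fun m => i m.+1)) (i 0%N).
Proof.
apply: eq_ext0 => j; rewrite ffunE; apply: (etrans (entry_sum _ _)).
by apply: eq_bigr => l _; rewrite entryZ.
Qed.

(* [E n *m F n] is a square matrix inserted at the bond [n], absorbed into the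
   neighbouring cores through this factorization. *)
Lemma entry_tt_tail (m : nat) (I r : nat -> nat)
    (G : forall n, tensor K [:: r n; I n; r n.+1]) (L : 'M[K]_(r m, I m))
    (R : nat) (M : nat -> nat -> 'M[K]_R) (v : nat -> 'cV[K]_R)
    (E : forall n, 'M[K]_(R, r n)) (F : forall n, 'M[K]_(r n, R))
    (i : nat -> nat) (a : 'I_(r 0%N)) :
    (forall n j, core_slice (G n) j = F n *m M n j *m E n.+1) ->
    (forall j, nat_col L j = F m *m v j) ->
  entry ((tt_tail G (mxtensor L) : {ffun 'I_(r 0%N) -> tensor K (sizes m.+1 I)}) a) i =
  (F 0%N *m (\prod_(0 <= n < m) (M n (i n) *m (E n.+1 *m F n.+1) : 'M_R))
     *m v (i m)) a 0.
Proof.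
elim: m I r G L M E F i a => [|m IHm] I r G L M E F i a GE LE.
  rewrite big_geq //= mulmx1 -LE /nat_col /ext0 ffunE.
  by case: insub => [j|] /=; rewrite ?ffunE mxE.
rewrite big_nat_recl // -[tt_tail _ _]/(@contract K [:: _; _] _ _ _ _).
rewrite [X in entry X]ffunE entry_contract.
set c := (X in _ = (X *m _) a 0).
(* Regrouping makes the slice of the first core the left factor; the rest is the induction
   hypothesis for the shifted families. *)
have -> : c *m v (i m.+1) = core_slice (G 0%N) (i 0%N) *m
    (F 1%N *m (\prod_(0 <= n < m) (M n.+1 (i n.+1) *m (E n.+2 *m F n.+2) : 'M_R))
    *m v (i m.+1)) by rewrite GE /c -!mulmxA.
rewrite /core_slice /ext0; case: insub => [j|] /=; last by rewrite mul0mx mxE.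
rewrite mxE; apply: eq_bigr => l _; rewrite mxE; congr (_ * _).
exact: (IHm (fun n => I n.+1) (fun n => r n.+1) (fun n => G n.+1) L
  (fun n => M n.+1) (fun n => E n.+1) (fun n => F n.+1)).
Qed.

(** Taking [E] and [F] to be identities gives the usual product formula; taking them to be a rank
    factorization describes a train with smaller bonds. *)
Lemma entry_tensor_train (N : nat) (I r : nat -> nat) (G1 : 'M[K]_(I 1%N, r 1%N))
    (G : forall n, tensor K [:: r n.-1; I n; r n]) (GN : 'M[K]_(r N.-1, I N))
    (R : nat) (u : nat -> 'rV[K]_R) (M : nat -> nat -> 'M[K]_R)
    (v : nat -> 'cV[K]_R)
    (E : forall n, 'M[K]_(R, r n)) (F : forall n, 'M[K]_(r n, R))
    (i : nat -> nat) :
    (1 < N)%N ->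
    (forall j, nat_row G1 j = u j *m E 1%N) ->
    (forall n j, core_slice (G n) j = F n.-1 *m M n j *m E n) ->
    (forall j, nat_col GN j = F N.-1 *m v j) ->
  entry (tensor_train G1 G GN) (fun n => i n.+1) =
  (u (i 1%N) *m (E 1%N *m F 1%N)
    *m (\prod_(2 <= n < N) (M n (i n) *m (E n *m F n) : 'M_R))
    *m v (i N)) 0 0.
Proof.
case: N GN => [|[|m]] GN // _ G1E GE GNE.
rewrite (big_addn 0 m.+2 2) !subSS subn0.
under eq_bigr do rewrite addn2.
set c := (X in _ = X 0 0).
have -> : c = nat_row G1 (i 1%N) *m
   (F 1%N *m (\prod_(0 <= n < m)
      (M n.+2 (i n.+2) *m (E n.+2 *m F n.+2) : 'M_R)) *m v (i m.+2)).
  by rewrite G1E /c -!mulmxA.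
rewrite [LHS]entry_contract /nat_row /ext0.
case: insub => [j|] /=; last by rewrite mul0mx mxE.
rewrite mxE; apply: eq_bigr => l _; rewrite !ffunE mxE; congr (_ * _).
exact: (@entry_tt_tail m (fun n => I n.+2) (fun n => r n.+1) (fun n => G n.+2)
  GN R (fun n => M n.+2) v (fun n => E n.+1) (fun n => F n.+1)
  (fun n => i n.+2) l (fun n => GE n.+2) GNE).
Qed.

(** * Entries of K-tensors *)

Lemma entry_rank1 (R N : nat) (I : nat -> nat)
    (A : forall n, 'M[K]_(I n, R)) (i : nat -> nat) (r : 'I_R) :
  entry (rank1 r (factors_of N A)) i =
  \prod_(0 <= n < N) nat_row (A n) (i n) 0 r.
Proof.
elim: N I A i => [|N IHN] I A i; first by rewrite big_geq.
rewrite big_nat_recl //= -IHN /nat_row /ext0.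
case: insub => [k|] /=; last by rewrite mxE mul0r.
by rewrite ffunE entryZ !mxE.
Qed.

Lemma entry_kruskal (R N : nat) (I : nat -> nat)
    (A : forall n, 'M[K]_(I n, R)) (i : nat -> nat) :
  entry (kruskal N A) (fun n => i n.+1) =
  \sum_r \prod_(1 <= n < N.+1) nat_row (A n) (i n) 0 r.
Proof.
rewrite entry_sum; apply: eq_bigr => r _.
rewrite big_add1 /=.
exact: (@entry_rank1 R N (fun n => I n.+1) (fun n => A n.+1)
  (fun n => i n.+1)).
Qed.

Lemma prod_diag_mx (R a b : nat) (d : nat -> 'rV[K]_R) :
  \prod_(a <= n < b) (diag_mx (d n) : 'M_R) =
  diag_mx (\row_r \prod_(a <= n < b) d n 0 r).
Proof.
elim: (index_iota a b) => [|n s IHs].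
  by rewrite big_nil; apply/matrixP => p q; rewrite !mxE big_nil.
rewrite big_cons IHs -[LHS]/(_ *m _) mul_diag_mx.
by apply/matrixP => p q; rewrite !mxE big_cons mulrnAr.
Qed.

(** The modes 1 and N are split off as a row and a column; the modes in between become diagonal
    cores, so the K-tensor has the form of a train. *)
Lemma entry_kruskal_diag (R N : nat) (I : nat -> nat)
    (A : forall n, 'M[K]_(I n, R)) (i : nat -> nat) : (1 < N)%N ->
  entry (kruskal N A) (fun n => i n.+1) =
  (nat_row (A 1%N) (i 1%N)
    *m (\prod_(2 <= n < N) (diag_mx (nat_row (A n) (i n)) : 'M_R))
    *m nat_col (A N)^T (i N)) 0 0.
Proof.
move=> N_gt1; rewrite entry_kruskal prod_diag_mx mxE; apply: eq_bigr => r _.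
rewrite mul_mx_diag !mxE nat_col_tr mxE.
by rewrite big_ltn ?ltnS 1?ltnW // big_nat_recr // mulrA.
Qed.

(** * Spanning families and changes of basis *)

Lemma finite_span (T : Type) (R : nat) (f : T -> 'rV[K]_R) :
  exists m (t : 'I_m -> T), forall x, (f x <= \matrix_j f (t j))%MS.
Proof.
(* [d] bounds the rank still missing, starting from [R] for the empty family; adding a vector
   outside the span raises the rank. *)
suff ext d m (t : 'I_m -> T) : (R <= \rank (\matrix_j f (t j)) + d)%N ->
    exists m (t : 'I_m -> T), forall x, (f x <= \matrix_j f (t j))%MS.
  have t0 : 'I_0 -> T by case.
  by apply: (ext R _ t0); rewrite leq_addl.
elim: d m t => [|d IHd] m t rank_t.
  exists m, t => x; apply: submx_full.
  by rewrite addn0 in rank_t; rewrite /row_full eqn_leq rank_leq_col.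
have [tP|] := pselect (forall x, (f x <= \matrix_j f (t j))%MS).
  by exists m, t.
move/existsNP => [x /negP ftx].
pose t' (j : 'I_(m + 1)) := if split j is inl k then t k else x.
apply: (IHd _ t'); apply: leq_trans rank_t _.
rewrite addnS -addSn leq_add2r.
have -> : \matrix_j f (t' j) = col_mx (\matrix_j f (t j)) (f x).
  apply/row_matrixP => j; rewrite rowK /t' -{2}(splitK j).
  case: (split j) => k /=; first by rewrite rowKu rowK.
  by rewrite rowKd; apply/rowP => l; rewrite !mxE ord1.
by apply: rank_ltmx; rewrite ltmxE -!addsmxE addsmxSl addsmx_sub submx_refl.
Qed.


Lemma row_full_cancel (T : Type) (R p m : nat) (f : T -> 'rV[K]_R) (t : 'I_m -> T)
    (B C : 'M[K]_(R, p)) :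
  row_full (\matrix_j f (t j)) -> (forall x, f x *m B = f x *m C) -> B = C.
Proof.
move=> full_f eqBC; apply: (row_full_inj full_f).
by apply/row_matrixP => j; rewrite !row_mul rowK.
Qed.

(** Since the [r (s k)] span, they can be cancelled on the right, which gives [l i = l' i *m V]. The
    [l (t j)] span and lie in the row space of [V], so [V] is invertible and [W] is its inverse.
    Cancelling [l] on the left then relates [r] to [r']. *)
Lemma interface_change (T S : Type) (R m p : nat) (l l' : T -> 'rV[K]_R)
    (r r' : S -> 'cV[K]_R) (t : 'I_m -> T) (s : 'I_p -> S) :
    (forall i j, l i *m r j = l' i *m r' j) ->
    row_full (\matrix_j l (t j)) -> row_full (\matrix_k (r (s k))^T) ->
  exists W : 'M[K]_R, [/\ W \in unitmx, forall i, l' i = l i *m W &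
    forall j, r j = W *m r' j].
Proof.
move=> eq_lr full_l full_r.
set Z := (X in row_full X) in full_r.
pose C := \matrix_k (r' (s k))^T.
have lE i : l i *m Z^T = l' i *m C^T.
  apply/matrixP => a k; have /matrixP /(_ a 0) := eq_lr i (s k).
  rewrite !mxE => eqk; under eq_bigr do rewrite !mxE.
  by rewrite eqk; apply: eq_bigr => b _; rewrite !mxE.
pose V := C^T *m (pinvmx Z)^T.
have lV i : l i = l' i *m V.
  by rewrite mulmxA -lE -mulmxA -trmx_mul mulVpmx // trmx1 mulmx1.
have V_unit : V \in unitmx.
  rewrite -row_full_unit -sub1mx; apply: submx_trans (_ : _ <= \matrix_j l (t j))%MS _.
    by rewrite sub1mx.
  by apply/row_subP => j; rewrite rowK lV submxMl.
have lW i : l' i = l i *m invmx V by rewrite lV mulmxK.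
exists (invmx V); split => //; first by rewrite unitmx_inv.
move=> j; apply: (row_full_cancel full_l) => i.
by rewrite eq_lr lW mulmxA.
Qed.

(** * Left and right partial products at a bond *)

Section Train.
Variables (R : nat) (u : nat -> 'rV[K]_R) (M : nat -> nat -> 'M[K]_R)
  (v : nat -> 'cV[K]_R) (N : nat).

Definition left_interface (n : nat) (i : nat -> nat) : 'rV[K]_R :=
  u (i 1%N) *m (\prod_(2 <= k < n.+1) (M k (i k) : 'M_R)).

Definition right_interface (n : nat) (i : nat -> nat) : 'cV[K]_R :=
  (\prod_(n.+1 <= k < N) (M k (i k) : 'M_R)) *m v (i N).

Lemma left_interface1 i : left_interface 1 i = u (i 1%N).
Proof. by rewrite /left_interface big_geq ?mulmx1. Qed.

Lemma left_interfaceS n i : (1 <= n)%N ->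
  left_interface n.+1 i = left_interface n i *m M n.+1 (i n.+1).
Proof. by move=> n_gt0; rewrite /left_interface big_nat_recr // -mulmxA. Qed.

Lemma right_interface_last i : (0 < N)%N -> right_interface (N - 1)%N i = v (i N).
Proof. by move=> N_gt0; rewrite /right_interface big_geq ?mul1mx ?subn1 ?prednK. Qed.

Lemma insert_bond (P : nat -> 'M[K]_R) n i :
    (1 <= n < N)%N -> (forall k, k != n -> P k = 1%:M) ->
  u (i 1%N) *m P 1%N *m (\prod_(2 <= k < N) (M k (i k) *m P k : 'M_R)) *m v (i N) =
  left_interface n i *m P n *m right_interface n i.
Proof.
move=> /andP[n_gt0 ltnN] P1.
have Pright : \prod_(n.+1 <= k < N) (M k (i k) *m P k : 'M_R) =
    \prod_(n.+1 <= k < N) (M k (i k) : 'M_R).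
  by apply: eq_big_nat => k /andP[ltnk _]; rewrite P1 ?gtn_eqF // mulmx1.
(* Bond 1 is separate because [P 1] stands outside the product over the inner modes. *)
case: n n_gt0 ltnN P1 Pright => [|[|n]] // _ ltnN P1 Pright.
  by rewrite left_interface1 Pright /right_interface !mulmxA.
rewrite (big_cat_nat (n := n.+3)) //= Pright P1 // mulmx1 /right_interface.
rewrite left_interfaceS // big_nat_recr //=.
under eq_big_nat => k /andP[_ ltkn] do rewrite P1 ?ltn_eqF // mulmx1.
by rewrite /left_interface -!mulmxA.
Qed.

Lemma train_split n i : (1 <= n < N)%N ->
  u (i 1%N) *m (\prod_(2 <= k < N) (M k (i k) : 'M_R)) *m v (i N) =
  left_interface n i *m right_interface n i.
Proof.
move=> nN; have := insert_bond (P := fun=> 1%:M) i nN (fun _ _ => erefl).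
by rewrite !mulmx1 => <-; under [in RHS]eq_bigr do rewrite mulmx1.
Qed.

(** The left interface at bond [n] sees only the modes up to [n], the right one only the later
    modes. Splicing two multi-indices lets the two sides vary independently. *)
Definition splice (n : nat) (i j : nat -> nat) (k : nat) : nat :=
  if (k <= n)%N then i k else j k.

Lemma left_interface_splice n i j : (1 <= n)%N ->
  left_interface n (splice n i j) = left_interface n i.
Proof.
move=> n_gt0; rewrite /left_interface /splice n_gt0; congr (_ *m _).
by apply: eq_big_nat => k /andP[_]; rewrite ltnS => ->.
Qed.

Lemma right_interface_splice n i j : (n < N)%N ->
  right_interface n (splice n i j) = right_interface n j.
Proof.
move=> ltnN; rewrite /right_interface /splice [(N <= n)%N]leqNgt ltnN; congr (_ *m _).
by apply: eq_big_nat => k /andP[ltnk _]; rewrite leqNgt ltnk.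
Qed.

End Train.

(** * Cores described by their slices *)

Lemma core_slice_inj p n q (S T : tensor K [:: p; n; q]) :
  core_slice S =1 core_slice T -> S = T.
Proof.
move=> eqST; apply/ffunP => a; apply/ffunP => j; apply/ffunP => b.
by have /matrixP/(_ a b) := eqST j; rewrite /core_slice !ext0_ord !mxE.
Qed.

Lemma core_slice_ffun p n q (X : 'I_n -> 'M[K]_(p, q)) :
  core_slice ([ffun a => [ffun j => [ffun b => (X j a b : K^o)] : tensor K [:: q]]
                : tensor K [:: n; q]] : tensor K [:: p; n; q]) =1 ext0 X.
Proof. by move=> i; apply: eq_ext0 => j; apply/matrixP => a b; rewrite mxE !ffunE. Qed.

Lemma core_slice_ktensor3 p n q R (Q : 'M[K]_(p, R)) (B : 'M[K]_(n, R))
    (S : 'M[K]_(q, R)) j :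
  core_slice (ktensor3 Q B S) j = Q *m diag_mx (nat_row B j) *m S^T.
Proof.
rewrite /nat_row -(ext0_comp (g := fun d => Q *m diag_mx d *m S^T)); last first.
  by rewrite raddf0 mulmx0 mul0mx.
apply: eq_ext0 => k; apply/matrixP => a b; rewrite /= mul_mx_diag !mxE.
(* Evaluation at a fixed entry is additive, so it passes through the sum of rank-one terms. *)
pose ev (T : tensor K [:: p; n; q]) : K :=
  (((T : {ffun 'I_p -> tensor K [:: n; q]}) a
     : {ffun 'I_n -> tensor K [:: q]}) k : {ffun 'I_q -> K^o}) b.
transitivity (\sum_r ev (@rank1 K R r [:: p; n; q] (Q, (B, (S, tt))))).
  by apply: (big_morph ev) => [T U|]; rewrite /ev !ffunE.
by apply: eq_bigr => r _; rewrite /ev !ffunE !mxE /= [_ *: _]mulrA [_ *: _]mulr1.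
Qed.

(** * Consequences of the minimality of the TT-rank *)

Lemma tt_rank_bond N R (I : nat -> nat) (Y : tensor K (sizes N (fun n => I n.+1)))
    (G1 : 'M[K]_(I 1%N, R)) (G : forall n, tensor K [:: R; I n; R])
    (GN : 'M[K]_(R, I N)) (P : nat -> 'M[K]_R) :
    (1 < N)%N -> tt_rank Y (fun=> R) ->
    (forall i, entry Y (fun n => i n.+1) =
      (nat_row G1 (i 1%N) *m P 1%N
        *m (\prod_(2 <= n < N) (core_slice (G n) (i n) *m P n : 'M_R))
        *m nat_col GN (i N)) 0 0) ->
  forall n, (1 <= n < N)%N -> \rank (P n) = R.
Proof.
move=> N_gt1 [_ minY] YE n nN; apply/eqP; rewrite eqn_leq rank_leq_row /=.
(* Each [P n] is [col_base (P n) *m row_base (P n)]. The first factor is absorbed into the core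
   before the bond, the second into the core after it. *)
suff /minY/(_ n nN) : has_tt Y (fun n => \rank (P n)) by [].
exists (G1 *m col_base (P 1%N)), (fun n => [ffun a => [ffun j : 'I_(I n) => [ffun b =>
  ((row_base (P n.-1) *m core_slice (G n) j *m col_base (P n)) a b : K^o)]
  : tensor K [:: _]] : tensor K [:: _; _]]), (row_base (P N.-1) *m GN).
apply: entry_inj => i; pose i' n := i n.-1.
rewrite -[i]/(fun n => i' n.+1) YE.
rewrite (entry_tensor_train (u := nat_row G1) (M := fun n => core_slice (G n))
   (v := nat_col GN) (E := fun n => col_base (P n)) (F := fun n => row_base (P n))) //.
- by rewrite mulmx_base; under [in RHS]eq_bigr do rewrite mulmx_base.
- by move=> j; rewrite nat_row_mulmx.
- move=> k j; rewrite core_slice_ffun.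
  rewrite /core_slice -(ext0_comp (g := fun X => row_base (P k.-1) *m X *m col_base (P k))).
    by apply: eq_ext0 => l /=; rewrite ext0_ord.
  by rewrite mulmx0 mul0mx.
- by move=> j; rewrite nat_col_mulmx.
Qed.

Lemma entry_tensor_train1 N R (I : nat -> nat)
    (G1 : 'M[K]_(I 1%N, R)) (G : forall n, tensor K [:: R; I n; R])
    (GN : 'M[K]_(R, I N)) i : (1 < N)%N ->
  entry (@tensor_train K N I (fun _ => R) G1 G GN) (fun n => i n.+1) =
  (nat_row G1 (i 1%N)
    *m (\prod_(2 <= n < N) (core_slice (G n) (i n) : 'M_R))
    *m nat_col GN (i N)) 0 0.
Proof.
move=> N_gt1.
rewrite (entry_tensor_train (u := nat_row G1) (M := fun n => core_slice (G n))
   (v := nat_col GN) (E := fun=> 1%:M) (F := fun=> 1%:M)) //.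
- by rewrite !mulmx1; under eq_bigr do rewrite !mulmx1.
- by move=> j; rewrite mulmx1.
- by move=> k j; rewrite mulmx1 mul1mx.
- by move=> j; rewrite mul1mx.
Qed.

Section Minimal.
Variables (N R : nat) (I : nat -> nat).
Variables (Y : tensor K (sizes N (fun n => I n.+1))).
Variables (G1 : 'M[K]_(I 1%N, R)) (G : forall n, tensor K [:: R; I n; R]).
Variable (GN : 'M[K]_(R, I N)).
Hypotheses (N_gt1 : (1 < N)%N) (rankY : tt_rank Y (fun=> R)).
Hypothesis YE : Y = @tensor_train K N I (fun=> R) G1 G GN.

Let l := left_interface (nat_row G1) (fun n => core_slice (G n)).
Let r := right_interface (fun n => core_slice (G n)) (nat_col GN) N.

Let bond_rank n (P : 'M[K]_R) : (1 <= n < N)%N ->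
  (forall i, l n i *m r n i = l n i *m P *m r n i) -> \rank P = R.
Proof.
move=> nN eqP.
(* [P] is inserted at bond [n] alone, with identities at all other bonds. *)
pose P' k := if k == n then P else 1%:M.
have P'n : P' n = P by rewrite /P' eqxx.
rewrite -P'n.
apply: (tt_rank_bond (G1 := G1) (G := G) (GN := GN) N_gt1 rankY _ nN) => i.
rewrite (insert_bond _ (fun k => core_slice (G k)) _ i nN); last first.
  by rewrite /P' => k /negPf ->.
by rewrite P'n -[in RHS]eqP -train_split // YE entry_tensor_train1.
Qed.

(** The projection [pinvmx X *m X] fixes the row space of [X], hence every left interface, so
    inserting it does not change the tensor. It therefore has rank [R], while its rank is at most
    that of [X]. *)
Lemma left_interface_full n : (1 <= n < N)%N ->
  exists m (t : 'I_m -> nat -> nat), row_full (\matrix_j l n (t j)).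
Proof.
move=> nN; have [m [t lX]] := finite_span (l n).
exists m, t; set X := (X in row_full X) in lX *.
rewrite /row_full eqn_leq rank_leq_col /=.
rewrite -{1}(bond_rank (P := pinvmx X *m X) nN) ?mxrankM_maxr //.
by move=> i; rewrite mulmxA mulmxKpV.
Qed.

Lemma right_interface_full n : (1 <= n < N)%N ->
  exists m (t : 'I_m -> nat -> nat), row_full (\matrix_j (r n (t j))^T).
Proof.
move=> nN; have [m [t rX]] := finite_span (fun i => (r n i)^T).
exists m, t; set X := (X in row_full X) in rX *.
rewrite /row_full eqn_leq rank_leq_col /=.
rewrite -{1}(bond_rank (P := (pinvmx X *m X)^T) nN) ?mxrank_tr ?mxrankM_maxr //.
move=> i; rewrite -mulmxA; congr (_ *m _).
by rewrite -[in RHS](trmxK (r n i)) -trmx_mul mulmxA mulmxKpV // trmxK.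
Qed.

End Minimal.

End Entries.

(** * Comparison of the given train with the diagonal one *)

Theorem lemma3 (K : realType) (N R : nat) (I : nat -> nat)
    (Y : tensor K (sizes N (fun n => I n.+1)))
    (A : forall n : nat, 'M[K]_(I n, R))
    (G1 : 'M[K]_(I 1%N, R))
    (G : forall n : nat, tensor K [:: R; I n; R])
    (GN : 'M[K]_(R, I N))
    (hN : (3 <= N)%N)
    (hcpd : unique_cpd Y A)
    (httrank : tt_rank Y (fun _ => R))
    (htt : Y = @tensor_train K N I (fun _ => R) G1 G GN) :
  exists (Q S : nat -> 'M[K]_R) (gamma : nat -> 'rV[K]_R),
    [/\ forall n : nat, (2 <= n <= N - 1)%N ->
          G n = ktensor3 (Q n) (A n) (S n),
        A 1%N = G1 *m Q 2%N *m diag_mx (gamma 1%N),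
        A N = GN^T *m S (N - 1)%N *m diag_mx (gamma N),
        forall n : nat, (2 <= n <= N - 2)%N ->
          (S n)^T *m Q n.+1 = diag_mx (gamma n) &
        hadamard (\big[@hadamard K 1 R/const_mx 1]_(1 <= n < (N - 2).+1) gamma n)
                 (gamma N)
          = const_mx 1].
Proof.
have N_gt1 : (1 < N)%N by apply: ltnW.
have [[_ YA] _] := hcpd.
pose l := left_interface (nat_row G1) (fun n => core_slice (G n)).
pose r := right_interface (fun n => core_slice (G n)) (nat_col GN) N.
pose D n j := diag_mx (nat_row (A n) j).
pose l' := left_interface (nat_row (A 1%N)) D.
pose r' := right_interface D (nat_col (A N)^T) N.
have /choice [W WP] : forall n, exists W : 'M[K]_R, (1 <= n < N)%N ->
    [/\ W \in unitmx, forall i, l' n i = l n i *m W &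
      forall j, r n j = W *m r' n j].
  move=> n; have [nN|] := boolP (1 <= n < N)%N; last by exists 0.
  have [n_gt0 ltnN] := andP nN.
  have [m [t full_l]] := left_interface_full N_gt1 httrank htt nN.
  have [p [s full_r]] := right_interface_full N_gt1 httrank htt nN.
  have [i j|W WP] := interface_change (l' := l' n) (r' := r' n) _ full_l full_r.
    (* All four interfaces are moved to the multi-index [splice n i j], where both products are the
       same entry of [Y]. *)
    rewrite /l /l' /r /r' -(left_interface_splice _ _ i j n_gt0).
    rewrite -(right_interface_splice _ _ i j ltnN).
    rewrite -(left_interface_splice _ D i j n_gt0).
    rewrite -(right_interface_splice D _ i j ltnN).
    rewrite -!train_split //; apply/matrixP => a b; rewrite !ord1.
    by rewrite -entry_tensor_train1 // -htt YA entry_kruskal_diag.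
  by exists W.
(* Both sides agree after multiplication on the left by any left interface at bond [n.-1], since
   both then give the diagonal train's left interface at bond [n]. These left interfaces span, so
   they cancel. *)
have W_core n j : (2 <= n < N)%N -> W n.-1 *m D n j = core_slice (G n) j *m W n.
  case: n => [|n] // /andP[n_gt0 ltnN]; rewrite ltnS in n_gt0.
  have nN : (1 <= n < N)%N by rewrite n_gt0 ltnW.
  have [m [t full_l]] := left_interface_full N_gt1 httrank htt nN.
  apply: (row_full_cancel full_l) => i.
  have [_ lW _] := WP n nN; have [|_ lSW _] := WP n.+1; first by rewrite ltnN.
  (* The first [n] indices stay arbitrary while mode [n.+1] takes the value [j]. *)
  have := lSW (splice n i (fun=> j)).
  rewrite /l /l' !left_interfaceS // !left_interface_splice // /splice ltnn.
  by rewrite -/(l n i) -/(l' n i) lW !mulmxA.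
exists (fun n => W n.-1), (fun n => (invmx (W n))^T), (fun=> const_mx 1).
rewrite !diag_const_mx !mulmx1; split.
- move=> n /andP[n_gt1 leqnN].
  have ltnN : (n < N)%N by rewrite -[N](@subnK 1) ?addn1 // ltnW.
  have [|W_unit _ _] := WP n; first by rewrite ltnW.
  apply: core_slice_inj => j.
  by rewrite core_slice_ktensor3 trmxK W_core ?n_gt1 // mulmxK.
- apply: nat_row_inj => j; rewrite nat_row_mulmx.
  have [|_ lW _] := WP 1%N; first by rewrite N_gt1.
  by have := lW (fun=> j); rewrite /l /l' !left_interface1.
(* At the last bond the right interfaces are the columns of [GN] and of [(A N)^T], so [GN] is
   [W (N - 1) *m (A N)^T]. *)
- have [|W_unit _ rW] := WP (N - 1)%N.
    by rewrite subn_gt0 N_gt1 subn1 prednK ?leqnn // ltnW.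
  apply: nat_row_inj => j.
  apply: trmx_inj; rewrite -!nat_col_tr trmx_mul !trmxK nat_col_mulmx.
  have := rW (fun=> j); rewrite /r /r' !right_interface_last ?(ltnW N_gt1) // => ->.
  by rewrite mulKmx.
- move=> n /andP[n_gt1 leqnN]; rewrite trmxK mulVmx //.
  have [|] // := WP n; rewrite (ltnW n_gt1) /=.
  by rewrite (leq_ltn_trans leqnN) // ltn_subrL (ltnW N_gt1).
- have one1 : hadamard (const_mx 1) (const_mx 1) = const_mx 1 :> 'rV[K]_R.
    by apply/matrixP => a b; rewrite !mxE mulr1.
  rewrite (_ : \big[_/_]_(_ <= _ < _) _ = const_mx 1) //.
  by elim/big_ind: _ => // _ _ -> ->; rewrite one1.
Qed.
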